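(* For all $n\geq 1$ and $k\ge 0$, the number $b_{n,k}(231,312)$ of permutations $\pi\in\mathfrak{S}_n(231,312)$ with $\mathrm{bdes}(\pi)=k$ is $$b_{n,k}(231,312)=\begin{cases} 2^{n-1}, & \text{if }k=0,\\ 0, & \text{otherwise.}\end{cases}$$
   Context: $\mathfrak{S}_n$ is the set of permutations $\pi=\pi_1\pi_2\cdots\pi_n$ of $[n]=\{1,\dots,n\}$ in one-line notation. $\mathfrak{S}_n(231,312)$ is the set of $\pi\in\mathfrak{S}_n$ having no length-three subsequence with the same relative order as $231$ or as $312$. An index $k\in[n-1]$ is a big descent of $\pi\in\mathfrak{S}_n$ if $\pi_k>\pi_{k+1}+1$; $\mathrm{bdes}(\pi)$ is the number of big descents of $\pi$. *)

(* Defs.v *)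
From mathcomp Require Import all_boot all_fingroup.

Set Implicit Arguments.
Unset Strict Implicit.
Unset Printing Implicit Defensive.

(* A permutation of {1, ..., n} is represented by p : 'S_n, acting on
   {0, ..., n-1}: positions and values are both shifted down by one.  Pattern
   containment and the condition p i > p j + 1 are invariant under the shift. *)

(* The pattern s is given in one-line notation, e.g. [:: 2; 3; 1] for 231; the
   function f lists the positions of an occurrence. *)
Definition contains (n : nat) (p : 'S_n) (s : seq nat) : bool :=
  [exists f : {ffun 'I_(size s) -> 'I_n},
     [forall i : 'I_(size s), forall j : 'I_(size s),
        (i < j) ==> (f i < f j)] &&
     [forall i : 'I_(size s), forall j : 'I_(size s),
        (p (f i) < p (f j)) == (nth 0 s i < nth 0 s j)]].

Definition avoids (n : nat) (p : 'S_n) (s : seq nat) : bool := ~~ contains p s.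

(* The position j following i must exist, so the last position is excluded. *)
Definition big_descents (n : nat) (p : 'S_n) : {set 'I_n} :=
  [set i : 'I_n | [exists j : 'I_n, (j == i.+1 :> nat) && (p i > p j + 1)]].

Definition bdes (n : nat) (p : 'S_n) : nat := #|big_descents p|.

(* The number b_{n,k}(Pi) of permutations avoiding every pattern in Pi and
   having exactly k big descents. *)
Definition bdes_count (n k : nat) (Pi : seq (seq nat)) : nat :=
  #|[set p : 'S_n | all (avoids p) Pi & bdes p == k]|.

(* Main.v *)
Require Import Defs.
From mathcomp Require Import all_boot all_fingroup.
From mathcomp Require Import zify.

(* An adjacent pair with p_k > p_{k+1} + 1 together with the value p_{k+1} + 1
   forms a 231 or a 312, so avoiders have no big descent.  If p avoids both
   patterns and i is not a descent, every entry up to i is smaller than every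
   entry after i; hence the descent set determines all comparisons between
   entries, that is, p itself.  Conversely every subset D of the n - 1 possible
   descents is realised, by reversing each maximal run of positions linked by
   D.  So avoiders correspond to subsets of an (n - 1)-element set. *)

(** Each pair is compared in both directions because [x], [y], [z] are arbitrary and might be
    equal. *)
Lemma contains3P (n : nat) (p : 'S_n) (x y z : nat) :
  reflect
    (exists a b c : 'I_n, [/\ a < b, b < c,
       ((p a < p b) = (x < y)) /\ ((p b < p a) = (y < x)),
       ((p b < p c) = (y < z)) /\ ((p c < p b) = (z < y)) &
       ((p a < p c) = (x < z)) /\ ((p c < p a) = (z < x))])
    (contains p [:: x; y; z]).
Proof.
apply: (iffP existsP) => [[f /andP[/forallP f_inc /forallP f_cmp]]|].
  have inc (i j : 'I_3) : i < j -> f i < f j by exact: (implyP (forallP (f_inc i) j)).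
  have cmp (i j : 'I_3) : (p (f i) < p (f j)) = (nth 0 [:: x; y; z] i < nth 0 [:: x; y; z] j).
    exact: (eqP (forallP (f_cmp i) j)).
  have lt0 : 0 < 3 by []. have lt1 : 1 < 3 by []. have lt2 : 2 < 3 by [].
  exists (f (Ordinal lt0)), (f (Ordinal lt1)), (f (Ordinal lt2)).
  by split; rewrite ?cmp //; apply: inc.
case=> a [b [c [ab bc [ab1 ab2] [bc1 bc2] [ac1 ac2]]]].
exists [ffun i : 'I_3 => nth a [:: a; b; c] i].
have ac := ltn_trans ab bc.
apply/andP; split; apply/forallP => i; apply/forallP => j; rewrite !ffunE;
  case: i j => [[|[|[|?]]] ?] [[|[|[|?]]] ?] //=;
  by rewrite ?ltnn ?ab1 ?ab2 ?bc1 ?bc2 ?ac1 ?ac2.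
Qed.

Lemma avoids231P (n : nat) (p : 'S_n) :
  reflect (forall a b c : 'I_n, a < b -> b < c -> p c < p a -> p b < p a)
          (avoids p [:: 2; 3; 1]).
Proof.
apply: (iffP idP) => [/contains3P av a b c ab bc pca | av].
  have := perm_inj (s := p) (x1 := a) (x2 := b).
  case: (ltngtP (p a) (p b)) => [pab _|//|/val_inj -> /(_ erefl) E].
    by case: av; exists a, b, c; split=> //; split=> /=; lia.
  by rewrite E ltnn in ab.
by apply/contains3P => -[a [b [c [ab bc [/= h1 _] _ [_ h2]]]]]; have := av a b c ab bc; lia.
Qed.

Lemma avoids312P (n : nat) (p : 'S_n) :
  reflect (forall a b c : 'I_n, a < b -> b < c -> p c < p a -> p c < p b)
          (avoids p [:: 3; 1; 2]).
Proof.
apply: (iffP idP) => [/contains3P av a b c ab bc pca | av].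
  have := perm_inj (s := p) (x1 := b) (x2 := c).
  case: (ltngtP (p c) (p b)) => [//|pbc _|/val_inj -> /(_ erefl) E].
    by case: av; exists a, b, c; split=> //; split=> /=; lia.
  by rewrite E ltnn in bc.
by apply/contains3P => -[a [b [c [ab bc _ [/= h1 _] [_ h2]]]]]; have := av a b c ab bc; lia.
Qed.

(** These are the layered permutations: direct sums of decreasing ones. *)
Definition layered (n : nat) : pred 'S_n :=
  fun p => avoids p [:: 2; 3; 1] && avoids p [:: 3; 1; 2].

Lemma layeredP (n : nat) (p : 'S_n) :
  reflect (forall a b c : 'I_n, a < b -> b < c -> p c < p a -> p c < p b < p a)
          (layered n p).
Proof.
apply: (iffP andP) => [[/avoids231P h1 /avoids312P h2] a b c ab bc pca | h].
  by rewrite (h1 a b c) ?(h2 a b c).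
by split; [apply/avoids231P | apply/avoids312P] => a b c ab bc pca;
  case/andP: (h a b c ab bc pca).
Qed.

Lemma bdes_layered (n : nat) (p : 'S_n) : layered n p -> bdes p = 0.
Proof.
move/layeredP => lay; apply: eq_card0 => i; rewrite inE.
apply/negbTE/negP => /existsP[j /andP[/eqP ij big]].
have lt_v : p j + 1 < n by apply: ltn_trans big (ltn_ord _).
(* The value at [v] lies strictly between those at [j] and [i]. If [v] is left of [i], then [v],
   [i], [j] form a 231; if right of [j], then [i], [j], [v] form a 312. *)
have [v vE] : exists v : 'I_n, p v = p j + 1 :> nat.
  by exists ((p^-1)%g (Ordinal lt_v)); rewrite permKV.
have vi : v != i by apply/eqP => E; rewrite E in vE; lia.
have vj : v != j by apply/eqP => E; rewrite E in vE; lia.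
have [lt|gt|/val_inj E] := ltngtP v i; last by rewrite E eqxx in vi.
  by have := lay v i j lt; lia.
have vj' : v <> j :> nat by move/val_inj => E; rewrite E eqxx in vj.
by have := lay i j v; lia.
Qed.

(** Standardization: each position is sent to its rank, the number of positions with a smaller
    key. *)
Lemma perm_of_keyP (n : nat) (key : 'I_n -> nat) :
  injective key -> exists p : 'S_n, forall i j, (p i < p j) = (key i < key j).
Proof.
move=> key_inj; pose below i := [set k | key k < key i].
have rank_lt i : #|below i| < n.
  rewrite -[X in _ < X]card_ord -cardsT; apply: proper_card.
  by apply/properP; split; [apply: subsetT | exists i; rewrite !inE ?ltnn].
have rank_mono i j : key i < key j -> #|below i| < #|below j|.
  move=> ij; apply: proper_card; apply/properP; split.
    by apply/subsetP => k; rewrite !inE => /ltn_trans; apply.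
  by exists i; rewrite inE ?ltnn.
have rank_inj : injective (fun i => Ordinal (rank_lt i)).
  move=> i j /(congr1 val) /= E; apply: key_inj.
  by case: (ltngtP (key i) (key j)) => // /rank_mono; rewrite E ltnn.
exists (perm rank_inj) => i j; rewrite !permE /=.
case: (ltngtP (key i) (key j)) => [/rank_mono //|/rank_mono ji|/key_inj ->].
  by rewrite ltnNge (ltnW ji).
by rewrite ltnn.
Qed.

(** As values start at 0, each entry equals the number of entries smaller than it, which the
    comparisons determine. *)
Lemma perm_eq_ltn (n : nat) (p q : 'S_n) :
  (forall i j, (p i < p j) = (q i < q j)) -> p = q.
Proof.
have rankE (s : 'S_n) i : s i = #|[set k | s k < s i]| :> nat.
  have -> : [set k | s k < s i] = s @^-1: [set v : 'I_n | v < s i].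
    by apply/setP => k; rewrite !inE.
  rewrite card_preimset; last exact: perm_inj.
  rewrite cardsE -sum1_card -(big_ord_widen n (fun _ => 1)) ?sum1_card ?card_ord //.
  exact: ltnW.
move=> E; apply/permP => i; apply: val_inj; rewrite /= [LHS]rankE [RHS]rankE.
by apply: eq_card => k; rewrite !inE E.
Qed.

(** Indexing by ['I_m] gives one index per adjacent pair: [lift ord_max i] is position [i] and
    [lift ord0 i] is position [i.+1]. *)
Definition descents (m : nat) (p : 'S_m.+1) : {set 'I_m} :=
  [set i : 'I_m | p (lift ord0 i) < p (lift ord_max i)].

(** An inversion [a], [b] around the ascent [x], [y] would shrink: layeredness makes [x], [b] an
    inversion, and then [x], [y], a contradiction. *)
Lemma lt_across_ascent (m : nat) (p : 'S_m.+1) (i : 'I_m) (a b : 'I_m.+1) :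
  layered m.+1 p -> i \notin descents m p -> a <= i -> i < b -> p a < p b.
Proof.
move=> /layeredP lay; rewrite inE -leqNgt => asc ai ib.
set x := lift ord_max i in asc; set y := lift ord0 i in asc.
have xE : x = i :> nat by rewrite /x lift_max.
have yE : y = i.+1 :> nat by [].
have neq (u v : 'I_m.+1) : u <> v :> nat -> p u <> p v :> nat.
  by move=> uv /val_inj /perm_inj E; rewrite E in uv.
have nab := neq a b; have nxy := neq x y.
case: (ltngtP (p a) (p b)) => [//|ba|]; last lia.
have xb : p b < p x.
  have [/val_inj <- //|ax] : a = x :> nat \/ a < x by lia.
  by have := lay a x b ax; lia.
have [/val_inj E|yb] : y = b :> nat \/ y < b by lia.
  by rewrite E in asc; lia.
by have := lay x y b; lia.
Qed.

Lemma gt_along_descents (m : nat) (p : 'S_m.+1) (a b : 'I_m.+1) :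
  a < b -> (forall i : 'I_m, a <= i < b -> i \in descents m p) -> p b < p a.
Proof.
case: b => b; elim: b => // b IH ltb; rewrite ltnS => ab des.
have lt_bm : b < m by [].
have := des (Ordinal lt_bm); rewrite inE ab ltnSn => /(_ isT).
have -> : lift ord0 (Ordinal lt_bm) = Ordinal ltb by apply: val_inj.
have -> : lift ord_max (Ordinal lt_bm) = Ordinal (ltnW ltb).
  by apply: val_inj; rewrite /= /bump leqNgt lt_bm.
move=> step; have [E|{}ab] : a = b :> nat \/ a < b by lia.
  by have -> : a = Ordinal (ltnW ltb) by apply: val_inj.
apply: ltn_trans step _; apply: IH => // i /andP[ai ib]; apply: des.
by rewrite ai ltnW.
Qed.

Lemma layered_ltnE (m : nat) (p : 'S_m.+1) (a b : 'I_m.+1) :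
  layered m.+1 p -> a < b ->
  (p a < p b) = [exists i : 'I_m, (a <= i < b) && (i \notin descents m p)].
Proof.
move=> lay ab; apply/idP/existsP => [pab | [i /andP[/andP[ai ib] asc]]]; last first.
  exact: lt_across_ascent lay asc ai ib.
apply/existsP; apply: contraLR pab; rewrite negb_exists => /forallP h.
rewrite -leqNgt ltnW //; apply: gt_along_descents => // i aib.
by move: (h i); rewrite aib negbK.
Qed.

Lemma descents_inj (m : nat) : {in layered m.+1 &, injective (descents m)}.
Proof.
move=> p q lp lq E; apply: perm_eq_ltn.
have lt_case (a b : 'I_m.+1) : a < b -> (p a < p b) = (q a < q b).
  by move=> ab; rewrite !layered_ltnE // E.
have gtE (s : 'S_m.+1) (a b : 'I_m.+1) : a < b -> (s b < s a) = ~~ (s a < s b).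
  move=> ab; have : s a <> s b :> nat.
    by move=> /val_inj/perm_inj F; rewrite F ltnn in ab.
  by lia.
move=> a b; have [ab|ba|/val_inj->] := ltngtP a b; first exact: lt_case.
  by rewrite (gtE p) // (gtE q) // lt_case.
by rewrite !ltnn.
Qed.

Lemma descents_surj (m : nat) (D : {set 'I_m}) :
  exists2 p : 'S_m.+1, layered m.+1 p & descents m p = D.
Proof.
(* blk numbers the blocks of the layered permutation from left to right; the
   key orders positions by block, and decreasingly within a block. *)
pose blk (a : nat) := #|[set i : 'I_m | (i < a) && (i \notin D)]|.
have blk_mono a b : a <= b -> blk a <= blk b.
  move=> ab; apply/subset_leq_card/subsetP => i; rewrite !inE.
  by case/andP=> ia ->; rewrite (leq_trans ia ab).
(* The factor [m.+1] exceeds every [m - a], so keys compare lexicographically. *)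
pose key (a : 'I_m.+1) := blk a * m.+1 + (m - a).
have key_lt (a b : 'I_m.+1) : a < b -> (key a < key b) = (blk a < blk b).
  move=> ab; have := blk_mono a b (ltnW ab); have := ltn_ord b; rewrite /key.
  by have [h|h|->] := ltngtP (blk a) (blk b); [nia | lia | lia].
have key_gt (a b : 'I_m.+1) : a < b -> (key b < key a) = (blk a == blk b).
  move=> ab; have := blk_mono a b (ltnW ab); have := ltn_ord b; rewrite /key.
  by have [h|h|->] := ltngtP (blk a) (blk b); [nia | lia | lia].
have key_inj : injective key.
  move=> a b E; apply: val_inj.
  by have [ab|ab|//] := ltngtP (a : nat) b;
    have := blk_mono _ _ (ltnW ab);
    have := key_lt _ _ ab; have := key_gt _ _ ab; rewrite E !ltnn; lia.
have [p pE] := perm_of_keyP _ key key_inj.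
exists p.
  (* An inversion [a], [c] lies within one block, and monotonicity of [blk] puts [b] in that block
     too. *)
  apply/layeredP => a b c ab bc; have ac := ltn_trans ab bc.
  rewrite !pE !key_gt // => /eqP ac_eq.
  by have := blk_mono a b (ltnW ab); have := blk_mono b c (ltnW bc); lia.
(* A descent at [i] now means [blk i = blk i.+1]. The sets counted by these two differ at most in
   [i], which is added exactly when it is outside [D]. *)
apply/setP => i; rewrite inE pE key_gt lift_max // [lift _ _ : nat]/= -[bump 0 i]/i.+1.
have [iD|iD] := boolP (i \in D).
  apply/eqP/eq_card => k; rewrite !inE ltnS (leq_eqVlt k).
  by have [/val_inj ->|] := eqVneq (k : nat) i; rewrite ?iD ?andbF.
apply/negbTE; rewrite neq_ltn; apply/orP; left.
apply: proper_card; apply/properP; split.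
  by apply/subsetP => k; rewrite !inE => /andP[ki ->]; rewrite ltnW.
by exists i; rewrite !inE ?ltnn ?ltnSn.
Qed.

Lemma card_layered (m : nat) : #|[set p | layered m.+1 p]| = 2 ^ m.
Proof.
rewrite -(card_in_imset (f := descents m)); last first.
  by move=> p q; rewrite !inE; apply: descents_inj.
have -> : descents m @: [set p | layered m.+1 p] = setT.
  apply/setP => D; rewrite inE; have [p lay <-] := descents_surj m D.
  by apply: imset_f; rewrite inE.
by rewrite -powersetT card_powerset cardsT card_ord.
Qed.

Theorem proposition3p14 (n k : nat) (hn : 1 <= n) :
  bdes_count n k [:: [:: 2; 3; 1]; [:: 3; 1; 2]] =
    if k == 0 then 2 ^ (n - 1) else 0.
Proof.
case: n hn => // m _; rewrite subn1 /bdes_count /=.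
have [->|k_neq0] := eqVneq k 0.
  (* For [k = 0] the counted set is that of all layered permutations, none of which has a big
     descent. *)
  rewrite -card_layered; apply: eq_card => p; rewrite !inE andbT.
  by rewrite andb_idr // => /bdes_layered ->.
apply: eq_card0 => p; rewrite !inE andbT.
by apply/negbTE/negP => /andP[/bdes_layered ->]; rewrite eq_sym (negbTE k_neq0).
Qed.
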